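(* Let $E$ be a complex Banach space which does not contain an isomorphic copy of $c_0$, and let $T\in\mathscr{L}(E)$ be a power-bounded operator. Let $x\in E$ be such that $(T-I)x$ is an asymptotically almost periodic vector with respect to $T$ and such that the sequence $\bigl((I-P)(T^n-I)x\bigr)_{n\in\mathbb{N}}$ converges in $E$ as $n\to\infty$. Then $x$ itself is an asymptotically almost periodic vector with respect to $T$.
   Context: $\mathscr{L}(E)$ denotes the bounded linear operators on $E$; $T$ is power-bounded if $\sup_{n\in\mathbb{N}}\|T^n\|<\infty$. $c_0$ is the Banach space of null sequences with the supremum norm; ''$E$ does not contain an isomorphic copy of $c_0$'' means no closed subspace of $E$ is linearly homeomorphic to $c_0$. A vector $x\in E$ is asymptotically almost periodic (a.a.p.) with respect to $T$ if $\{T^nx:n\in\mathbb{N}\}$ is relatively compact in $E$. The set $E_{\mathrm{aap}}$ of all a.a.p. vectors is a closed $T$-invariant subspace. By the Jacobs–de Leeuw–Glicksberg decomposition applied to $T|_{E_{\mathrm{aap}}}$, there is a bounded projection $P\in\mathscr{L}(E_{\mathrm{aap}})$ commuting with $T|_{E_{\mathrm{aap}}}$ whose range is $E_{\mathrm{r}}=\overline{\operatorname{span}}\{y\in E_{\mathrm{aap}}: Ty=\lambda y \text{ for some } \lambda\in\mathbb{C},\ |\lambda|=1\}$ and whose kernel is $E_{\mathrm{s}}=\{y\in E_{\mathrm{aap}}: T^ny\to 0 \text{ as } n\to\infty\}$; so $E_{\mathrm{aap}}=E_{\mathrm{r}}\oplus E_{\mathrm{s}}$. The projection $P$ is determined by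 these properties. If $(T-I)x\in E_{\mathrm{aap}}$, then $(T^n-I)x\in E_{\mathrm{aap}}$ for all $n\in\mathbb{N}$, so $(I-P)(T^n-I)x$ is well defined. *)

(* Defs.v *)
(* MathComp-Analysis; the complex scalars are [R[i]] for [R : realType]. *)
From HB Require Import structures.
From mathcomp Require Import all_boot all_order all_algebra.
From mathcomp Require Import all_classical all_reals all_analysis.
From mathcomp Require Export complex.

Set Implicit Arguments.
Unset Strict Implicit.
Unset Printing Implicit Defensive.

Import Order.TTheory GRing.Theory Num.Theory.
Import numFieldTopology.Exports numFieldNormedType.Exports.

Local Open Scope classical_set_scope.
Local Open Scope ring_scope.

(* In a [normedModType R[i]] the norm takes values in [R[i]] (nonnegative real
   elements); [rnorm] is the same norm with values in [R]. *)
Definition rnorm (R : realType) (E : normedModType R[i]) (x : E) : R :=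
  complex.Re `|x|.

Section RealNorm.
Variables (R : realType) (E : normedModType R[i]).
Implicit Types x y : E.

Lemma normE_rnorm x : `|x| = (rnorm x)%:C%C.
Proof.
rewrite /rnorm; have := normr_ge0 x.
by case: (`|x|) => a b; rewrite lecE /= => /andP[/eqP -> _].
Qed.

Lemma rnorm_ge0 x : 0 <= rnorm x.
Proof. by rewrite -lecR -normE_rnorm normr_ge0. Qed.

Lemma rnormD x y : rnorm (x + y) <= rnorm x + rnorm y.
Proof. by rewrite -lecR rmorphD /= -!normE_rnorm ler_normD. Qed.

Lemma rnorm0_eq0 x : rnorm x = 0 -> x = 0.
Proof. by move=> x0; apply/normr0_eq0; rewrite normE_rnorm x0. Qed.

Lemma rnormZ (l : R[i]) x : rnorm (l *: x) = rnorm (l : R[i]^o) * rnorm x.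
Proof.
apply: (@complexI R).
by rewrite rmorphM /= -!normE_rnorm normrZ.
Qed.

End RealNorm.

Section C0.
Variable R : realType.
Notation C := R[i]^o.

(* [R[i]^o] is [R[i]] seen as a normed module over itself; the alias is what
   carries the topology of the complex plane. *)
Definition null_seq : {pred nat -> C} := fun u => `[< u @ \oo --> (0 : C) >].

Lemma null_seqP (u : nat -> C) : reflect (u @ \oo --> (0 : C)) (u \in null_seq).
Proof. exact: asboolP. Qed.

Lemma null_seq_submod_closed : submod_closed null_seq.
Proof.
split=> [|a u v /null_seqP u0 /null_seqP v0].
  by apply/null_seqP; exact: cvg_cst.
apply/null_seqP; have := cvgD (cvgZl_tmp (k := a) u0) v0.
by rewrite scaler0 addr0; apply.
Qed.

HB.instance Definition _ :=
  GRing.isSubmodClosed.Build R[i] (nat -> C) null_seq null_seq_submod_closed.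

Record c0 := NullSeq { c0_seq :> nat -> C; _ : c0_seq \in null_seq }.

HB.instance Definition _ := [isSub for c0_seq].
HB.instance Definition _ := gen_eqMixin c0.
HB.instance Definition _ := gen_choiceMixin c0.
HB.instance Definition _ := [SubChoice_isSubLmodule of c0 by <:].

Implicit Types u v : c0.

Lemma c0_has_ubound u : has_ubound (range (fun n => rnorm (u n))).
Proof.
case: u => s /= /null_seqP /cvgP /cvg_seq_bounded /pinfty_ex_gt0[M M0 sM].
exists (complex.Re M) => _ [n _ <-].
have := sM n Logic.I; rewrite /= normE_rnorm.
by case: (M) => a b; rewrite lecE => /andP[].
Qed.

Lemma c0_has_sup u : has_sup (range (fun n => rnorm (u n))).
Proof. by split; [exists (rnorm (u 0%N)), 0%N|exact: c0_has_ubound]. Qed.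

Definition c0_norm u : R := sup (range (fun n => rnorm (u n))).

Lemma c0_norm_ub u n : rnorm (u n) <= c0_norm u.
Proof. by apply: (ub_le_sup (c0_has_ubound u)); exists n. Qed.

Lemma c0_norm_le u (M : R) : (forall n, rnorm (u n) <= M) -> c0_norm u <= M.
Proof.
by move=> uM; apply: ge_sup; [exact: (c0_has_sup u).1|move=> _ [n _ <-]].
Qed.

Lemma c0_normD u v :
  (c0_norm (u + v))%:C%C <= (c0_norm u)%:C%C + (c0_norm v)%:C%C.
Proof.
rewrite -rmorphD lecR; apply: c0_norm_le => n.
apply: le_trans (rnormD (u n) (v n)) _.
exact: lerD (c0_norm_ub u n) (c0_norm_ub v n).
Qed.

Lemma c0_normZ_le (l : R[i]) u : c0_norm (l *: u) <= rnorm (l : C) * c0_norm u.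
Proof.
apply: c0_norm_le => n.
rewrite (_ : rnorm _ = rnorm (l : C) * rnorm (u n)); last exact: rnormZ.
by rewrite ler_wpM2l ?rnorm_ge0 ?c0_norm_ub.
Qed.

Lemma c0_normZ (l : R[i]) u : (c0_norm (l *: u))%:C%C = `|l| * (c0_norm u)%:C%C.
Proof.
rewrite (_ : `|l| = (rnorm (l : C))%:C%C); last exact: (normE_rnorm (l : C)).
rewrite -rmorphM; congr (_%:C)%C; apply/le_anti; rewrite c0_normZ_le /=.
have [->|l0] := eqVneq l 0.
  rewrite [X in X * _](_ : _ = 0) ?mul0r; last by rewrite /rnorm normr0.
  exact: le_trans (rnorm_ge0 _) (c0_norm_ub _ 0%N).
have rl0 : 0 < rnorm (l : C).
  rewrite lt_neqAle rnorm_ge0 andbT eq_sym; apply: contra l0 => /eqP rl.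
  by apply/eqP; exact: (rnorm0_eq0 rl).
rewrite -ler_pdivlMl//; have := c0_normZ_le l^-1 (l *: u).
rewrite scalerA mulVf// scale1r.
suff -> : rnorm (l^-1 : C) = (rnorm (l : C))^-1 by [].
apply: (mulIf (lt0r_neq0 rl0)); rewrite mulVf ?lt0r_neq0//.
have := rnormZ (l^-1) (l : C).
rewrite (_ : l^-1 *: (l : C) = 1); last exact: mulVf.
by move=> <-; rewrite /rnorm normr1.
Qed.

Lemma c0_norm_eq0 u : (c0_norm u)%:C%C = 0 -> u = 0.
Proof.
move=> /(@complexI R) u0; apply/val_inj/funext => n.
apply: rnorm0_eq0; apply/le_anti; rewrite rnorm_ge0 andbT -u0.
exact: c0_norm_ub.
Qed.

HB.instance Definition _ :=
  Lmodule_isNormed.Build R[i] c0 c0_normD c0_normZ c0_norm_eq0.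

End C0.

Section Operators.
Variables (R : realType) (E : completeNormedModType R[i]).
Implicit Types (T : {linear E -> E}) (P : E -> E) (A : set E) (x y : E).

(* A linear homeomorphism of [c0 R] onto a closed subspace of [E]: the range of
   [J], with inverse [g], is automatically a linear subspace. *)
Definition contains_c0 : Prop :=
  exists (J : {linear c0 R -> E}) (g : E -> c0 R),
    [/\ closed (range J), continuous J, cancel J g
      & {within range J, continuous g}].

Definition opnorm (f : E -> E) : \bar R :=
  ereal_sup [set (rnorm (f x))%:E | x in [set x | rnorm x <= 1]].

Definition power_bounded T : Prop :=
  (ereal_sup (range (fun n : nat => opnorm (iter n T))) < +oo)%E.

Definition aap T : set E := [set x | precompact (range (fun n => iter n T x))].

Definition linear_span A : set E :=
  [set y | exists n (c : 'I_n -> R[i]) (a : 'I_n -> E),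
    (forall i, A (a i)) /\ y = \sum_(i < n) c i *: a i].

Definition unimodular_eigenvectors T : set E :=
  [set y | aap T y /\ exists2 l : R[i], `|l| = 1 & T y = l *: y].

Definition reversible_part T : set E :=
  closure (linear_span (unimodular_eigenvectors T)).

Definition stable_part T : set E :=
  [set y | aap T y /\ iter n T y @[n --> \oo] --> (0 : E)].

(* [P] is a total function of which only the restriction to [aap T] matters
   ([aap T] is a [T]-invariant closed subspace when [T] is power-bounded). *)
Record is_jdlg_projection T P : Prop := {
  jdlg_stable : forall y, aap T y -> aap T (P y);
  jdlg_linear : forall (l : R[i]) y z, aap T y -> aap T z ->
    P (l *: y + z) = l *: P y + P z;
  jdlg_bounded : exists M : R, forall y, aap T y -> rnorm (P y) <= M * rnorm y;
  jdlg_idempotent : forall y, aap T y -> P (P y) = P y;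
  jdlg_commute : forall y, aap T y -> P (T y) = T (P y);
  jdlg_range : P @` aap T = reversible_part T;
  jdlg_kernel : [set y | aap T y /\ P y = 0] = stable_part T
}.

End Operators.

(* Main.v *)
Require Import Defs.
From HB Require Import structures.
From mathcomp Require Import all_boot all_order all_algebra.
From mathcomp Require Import all_classical all_reals all_analysis.
From mathcomp Require Import finmap lra zify.

Set Implicit Arguments.
Unset Strict Implicit.
Unset Printing Implicit Defensive.

Import Order.TTheory GRing.Theory Num.Theory.
Import numFieldTopology.Exports numFieldNormedType.Exports.

Local Open Scope classical_set_scope.
Local Open Scope ring_scope.

(** Put [z := P (T x - x)] and [s n := \sum_(k < n) iter k T z].  Since [P] is
    linear and commutes with [T] on the asymptotically almost periodic
    vectors, telescoping gives [P (iter n T x - x) = s n], so that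
<<
      iter n T x = ((iter n T x - x) - P (iter n T x - x)) + s n + x.
>>
    The first summand converges by hypothesis.  It remains to see that the
    orbit sums [s n], which are bounded because [T] is power bounded, form a
    totally bounded sequence; this is a theorem of Kadets type on the
    summation of almost periodic sequences.

    As [z] lies in the closed span of unimodular eigenvectors, it is recurrent
    ([reversible_recurrent]): for every [e] the times can be coloured with
    finitely many colours so that two times of the same colour differ by some
    [t] for which [iter t T z] is [e]-close to [z].  As [s n] differs from
    [s m] by the image of [s (n - m)] under [iter m T], it suffices that [s t] is
    small whenever [iter t T z] is close enough to [z]
    ([small_return_small_sum]).  If this failed, one could choose ever better
    return times [t j] with [s (t j)] bounded away from zero and with all finite
    subset sums of the [s (t j)] bounded.

    By the criterion of Bessaga and Pelczynski
    ([bounded_subset_sums_contains_c0]) such vectors yield a copy of [c0].  It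
    rests here on a blocking argument of James.
    Far enough out, the sizes of the combinations with coefficients in the unit
    disc stabilize around a value [k]; consecutive blocks [u i] of size almost [k]
    then satisfy an upper estimate by almost [k], and flipping the sign of the
    largest coefficient turns it into a lower estimate ([block_lower]).  Hence
    mapping [b] to the sum of the [b i *: u i] embeds [c0] in [E]. *)

(** * The norm with real values *)

Section RealValuedNorm.
Variables (R : realType) (E : normedModType R[i]).
Implicit Types (x y : E) (f : nat -> E) (A : set E) (e : R).

Lemma rnorm0 : rnorm (0 : E) = 0.
Proof. by rewrite /rnorm normr0. Qed.

Lemma rnormN x : rnorm (- x) = rnorm x.
Proof. by rewrite /rnorm normrN. Qed.

Lemma rdistC x y : rnorm (x - y) = rnorm (y - x).
Proof. by rewrite -rnormN opprB. Qed.

Lemma rnormB x y : rnorm (x - y) <= rnorm x + rnorm y.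
Proof. by rewrite (le_trans (rnormD _ _))// rnormN. Qed.

Lemma rdistD z x y : rnorm (x - y) <= rnorm (x - z) + rnorm (z - y).
Proof. by rewrite (le_trans _ (rnormD _ _))// addrA subrK. Qed.

Lemma rnorm_gt0 x : x != 0 -> 0 < rnorm x.
Proof.
move=> x0; rewrite lt_neqAle rnorm_ge0 andbT eq_sym.
by apply: contra x0 => /eqP /rnorm0_eq0 ->.
Qed.

Lemma rnormZ_real (t : R) x : 0 <= t -> rnorm (t%:C%C *: x) = t * rnorm x.
Proof. by move=> t0; rewrite rnormZ {1}/rnorm ger0_norm// lecR. Qed.

(** The radii of balls are positive elements of the plane, hence real. *)
Lemma gt0_realP (z : R[i]) : 0 < z -> exists2 e : R, 0 < e & z = e%:C%C.
Proof. by case: z => a b; rewrite ltcE /= => /andP[/eqP-> a0]; exists a. Qed.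

Lemma ball_rnorm x y e : ball x e%:C%C y = (rnorm (x - y) < e) :> Prop.
Proof. by rewrite -ball_normE /ball_/= normE_rnorm ltcR. Qed.

(** Real-valued errors make linear arithmetic over [R] available. *)
Lemma cvgn_rnormP f l : f @ \oo --> l <->
  forall e, 0 < e -> exists N, forall n, (N <= n)%N -> rnorm (f n - l) <= e.
Proof.
split=> [/cvgrPdist_le fl e e0|fl].
  have /fl [N _ NP] : 0 < e%:C%C :> R[i] by rewrite ltcR.
  by exists N => n /NP /=; rewrite normE_rnorm lecR rdistC.
apply/cvgrPdist_le => _ /gt0_realP[e e0 ->]; have [N NP] := fl e e0.
by exists N => // n /= /NP; rewrite normE_rnorm lecR rdistC.
Qed.

Lemma cvgn_rnorm_le f l (B : R) :
  f @ \oo --> l -> (forall n, rnorm (f n) <= B) -> rnorm l <= B.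
Proof.
move=> /cvgn_rnormP fl fB; apply/ler_addgt0Pr => e /fl[N /(_ _ (leqnn N)) NP].
have := rdistD (f N) 0 l; rewrite !sub0r !rnormN => fe.
by rewrite (le_trans fe)// lerD// fB.
Qed.

Lemma cvgn_rnorm_ge f l (B : R) N : f @ \oo --> l ->
  (forall n, (N <= n)%N -> B <= rnorm (f n)) -> B <= rnorm l.
Proof.
move=> /cvgn_rnormP fl fB; apply/ler_addgt0Pr => e /fl[M MP].
have := rdistD l (f (maxn N M)) 0; rewrite !subr0 => fe.
have := MP _ (leq_maxr N M); have := fB _ (leq_maxl N M); lra.
Qed.

Lemma closure_rnormP A x :
  closure A x <-> forall e, 0 < e -> exists2 a, A a & rnorm (a - x) < e.
Proof.
split=> [Ax e e0|Ax B /nbhs_ballP[_ /gt0_realP[e e0 ->]] eB].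
  have /Ax [a [Aa]] : nbhs x (ball x e%:C%C) by apply: nbhsx_ballx; rewrite ltcR.
  by rewrite ball_rnorm rdistC => ?; exists a.
have [a Aa ax] := Ax e e0; exists a; split=> //.
by apply: eB; rewrite ball_rnorm rdistC.
Qed.

End RealValuedNorm.

Definition cauchy_seq (R : realType) (E : normedModType R[i]) (f : nat -> E) :=
  forall e : R, 0 < e ->
  exists N, forall m n, (N <= m)%N -> (N <= n)%N -> rnorm (f m - f n) <= e.

Lemma cauchy_seq_cvg (R : realType) (E : completeNormedModType R[i])
  (f : nat -> E) : cauchy_seq f -> exists l : E, f @ \oo --> l.
Proof.
move=> fC; suff /cauchy_cvg/cvg_ex : cauchy (f @ \oo) by [].
apply: cauchy_exP => _ /gt0_realP[e e0 ->].
have [N NP] := fC (e / 2) (divr_gt0 e0 (ltr0Sn R 1)).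
exists (f N), N => // n /= Nn.
rewrite ball_rnorm (le_lt_trans (NP _ _ (leqnn _) Nn))//; lra.
Qed.

Section ComplexModulus.
Variable R : realType.
Implicit Types z : R[i].

Lemma rnormC_def z :
  rnorm (z : R[i]^o) = Num.sqrt (complex.Re z ^+ 2 + complex.Im z ^+ 2).
Proof. by rewrite /rnorm (normc_def z). Qed.

Lemma Re_le_rnorm z : `|complex.Re z| <= rnorm (z : R[i]^o).
Proof. by rewrite rnormC_def -sqrtr_sqr ler_wsqrtr// lerDl sqr_ge0. Qed.

Lemma Im_le_rnorm z : `|complex.Im z| <= rnorm (z : R[i]^o).
Proof. by rewrite rnormC_def -sqrtr_sqr ler_wsqrtr// lerDr sqr_ge0. Qed.

Lemma rnorm_le_ReIm z :
  rnorm (z : R[i]^o) <= `|complex.Re z| + `|complex.Im z|.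
Proof.
have s0 : 0 <= `|complex.Re z| + `|complex.Im z| by rewrite addr_ge0.
rewrite rnormC_def -[leRHS]ger0_norm// -sqrtr_sqr ler_wsqrtr// sqrrD.
by rewrite !real_normK ?num_real// addrAC lerDl mulrn_wge0 ?mulr_ge0.
Qed.

(** Both coordinates of a Cauchy sequence of the plane are Cauchy sequences of
    the line. *)
Lemma complex_cauchy_seq_cvg (f : nat -> R[i]^o) :
  cauchy_seq f -> exists l : R[i]^o, f @ \oo --> l.
Proof.
move=> fC.
have real_cvg (p : R[i] -> R) :
    (forall z z', `|p z - p z'| <= rnorm (z - z' : R[i]^o)) ->
    exists l : R, forall e, 0 < e ->
      exists N, forall n, (N <= n)%N -> `|p (f n) - l| <= e.
  move=> pP; have /cauchy_cvg/cvg_ex[l fl] : cauchy ((fun n => p (f n)) @ \oo).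
    apply: cauchy_exP => e e0.
    have [N NP] := fC (e / 2) (divr_gt0 e0 (ltr0Sn R 1)).
    exists (p (f N)), N => // n /= Nn.
    rewrite -ball_normE /ball_/= (le_lt_trans (pP _ _))//.
    by rewrite (le_lt_trans (NP _ _ (leqnn _) Nn))//; lra.
  exists l => e e0; have [N _ NP] := (cvgrPdist_le _ _).1 fl _ e0.
  by exists N => n Nn; rewrite distrC; exact: NP.
have [|a fa] := real_cvg (@complex.Re R).
  by move=> z z'; rewrite (le_trans _ (Re_le_rnorm _))//; case: z z' => ? ? [].
have [|b fb] := real_cvg (@complex.Im R).
  by move=> z z'; rewrite (le_trans _ (Im_le_rnorm _))//; case: z z' => ? ? [].
exists (Complex a b); apply/cvgn_rnormP => e e0.
have e20 : 0 < e / 2 by rewrite divr_gt0.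
have [[N NP] [M MP]] := (fa _ e20, fb _ e20).
exists (maxn N M) => n; rewrite geq_max => /andP[/NP na /MP nb].
rewrite (le_trans (rnorm_le_ReIm _))//.
by move: na nb; case: (f n) => u v /=; lra.
Qed.

End ComplexModulus.

(** * Total boundedness by colourings *)

(** A pigeonhole form of compactness for relations between time indices.
    Stated with colours, it passes to conjunctions by pairing, where
    subsequences would have to be extracted one after the other. *)
Definition finitely_colorable (D : nat -> nat -> Prop) :=
  exists (K : finType) (c : nat -> K),
    forall m n, (m <= n)%N -> c m = c n -> D m n.

Lemma finitely_colorableW (D D' : nat -> nat -> Prop) :
  (forall m n, (m <= n)%N -> D m n -> D' m n) ->
  finitely_colorable D -> finitely_colorable D'.
Proof. by move=> DD' [K [c cD]]; exists K, c => m n mn /cD-/(_ mn)/DD'; exact. Qed.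

Lemma finitely_colorableI (D1 D2 D : nat -> nat -> Prop) :
  (forall m n, (m <= n)%N -> D1 m n -> D2 m n -> D m n) ->
  finitely_colorable D1 -> finitely_colorable D2 -> finitely_colorable D.
Proof.
move=> DD [K1 [c1 cD1]] [K2 [c2 cD2]].
exists (K1 * K2)%type, (fun n => (c1 n, c2 n)) => m n mn [e1 e2].
by apply: DD => //; [exact: cD1|exact: cD2].
Qed.

Section TotallyBoundedSequences.
Variables (R : realType) (E : completeNormedModType R[i]).
Implicit Types (f g : nat -> E) (e : R).

Definition totally_bounded_seq f := forall e, 0 < e ->
  finitely_colorable (fun m n => rnorm (f n - f m) <= e).

(** The colour of [n] is the centre of a ball, in a finite cover of the closure,
    that contains [f n]. *)
Lemma precompact_totally_bounded f :
  precompact (range f) -> totally_bounded_seq f.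
Proof.
rewrite precompactE compact_cover => fc e e0.
have e20 : 0 < e / 2 by rewrite divr_gt0.
have [|y /closure_rnormP/(_ _ e20)[_ [n _ <-] yn]|D _ fD] :=
    fc nat setT (fun n => ball (f n) (e / 2)%:C%C).
- by move=> n _; apply: ball_open; rewrite ltcR.
- by exists n => //; rewrite ball_rnorm.
have /choice[c cP] n : exists k : D, ball (f (val k)) (e / 2)%:C%C (f n).
  have [k kD kn] := fD _ (subset_closure (imageT f n)).
  by exists (FSetSub kD).
exists D, c => m n _ cmn; have := cP m; have := cP n.
rewrite cmn !ball_rnorm => cn cm; rewrite (le_trans (rdistD (f (val (c n))) _ _))//.
by rewrite rdistC; lra.
Qed.

(** An ultrafilter on the closure contains one of finitely many small balls, so
    that it is Cauchy and converges. *)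
Lemma totally_bounded_precompact f :
  totally_bounded_seq f -> precompact (range f).
Proof.
rewrite precompactE compact_ultra => fc F FU Ff.
have /cauchy_cvg/cvg_ex[l Fl] : cauchy F.
  apply: cauchy_exP => _ /gt0_realP[e e0 ->].
  have [K [c cP]] := fc (e / 2) (divr_gt0 e0 (ltr0Sn R 1)).
  apply: contrapT => noball.
  (* one missed ball per colour keeps [F] away from the whole sequence: its
     radius [e] exceeds the spread [e / 2] of the terms of that colour *)
  have /filter_ex[y [fy yN]] : F (closure (range f) `&`
      [set y | forall k : K, forall n, c n = k -> e / 2 <= rnorm (f n - y)]).
    apply: filterI => //; apply: filter_forall => k.
    have [[n nk]|nk] := pselect (exists n, c n = k); last first.
      by apply: filterS filterT => y _ n nk'; case: nk; exists n.
    have [Fb|Fb] := in_ultra_setVsetC (ball (f n) e%:C%C) FU.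
      by case: noball; exists (f n).
    apply: filterS Fb => y /=; rewrite ball_rnorm => /negP; rewrite -leNgt => ny.
    move=> n' nk'; have ff : rnorm (f n - f n') <= e / 2.
      case/orP: (leq_total n n') => nn'; last by apply: cP => //; rewrite nk nk'.
      by rewrite rdistC; apply: cP => //; rewrite nk nk'.
    by have := rdistD (f n') (f n) y; lra.
  have e20 : 0 < e / 2 by rewrite divr_gt0.
  have [_ [n _ <-] yn] := (closure_rnormP _ _).1 fy _ e20.
  by have := yN (c n) n erefl; lra.
exists l; split=> //.
exact: (@closed_cvg _ _ F _ id _ (@closed_closure _ (range f)) Ff l).
Qed.

Lemma totally_bounded_seqD f g : totally_bounded_seq f ->
  totally_bounded_seq g -> totally_bounded_seq (fun n => f n + g n : E).
Proof.
move=> fb gb e e0; have e20 : 0 < e / 2 by rewrite divr_gt0.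
apply: finitely_colorableI (fb _ e20) (gb _ e20) => m n _ fe ge.
by rewrite opprD addrACA (le_trans (rnormD _ _))//; lra.
Qed.

Lemma totally_bounded_seqZ (l : R[i]) f : totally_bounded_seq f ->
  totally_bounded_seq (fun n => l *: f n : E).
Proof.
move=> fb e e0; have l0 : 0 < rnorm (l : R[i]^o) + 1 by rewrite ltr_wpDl ?rnorm_ge0.
apply: finitely_colorableW (fb _ (divr_gt0 e0 l0)) => m n _.
rewrite -scalerBr rnormZ ler_pdivlMr// => fe.
by rewrite (le_trans _ fe)// mulrC ler_wpM2l ?rnorm_ge0// lerDl.
Qed.

Lemma totally_bounded_seq_cst (y : E) : totally_bounded_seq (fun _ : nat => y).
Proof.
by move=> e /ltW e0; exists unit, (fun=> tt) => m n _ _; rewrite subrr rnorm0.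
Qed.

(** All late times share one colour, and each earlier time has its own. *)
Lemma cvg_totally_bounded f (y : E) :
  f @ \oo --> y -> totally_bounded_seq f.
Proof.
move=> /cvgn_rnormP fy e e0; have [N NP] := fy _ (divr_gt0 e0 (ltr0Sn R 1)).
exists 'I_N.+1, (fun n => inord (minn n N)) => m n mn /(congr1 val) /=.
rewrite !inordK ?ltnS ?geq_minr//; have [Nm _|mN] := leqP N m.
  have := NP _ Nm; have := NP _ (leq_trans Nm mn).
  by have := rdistD y (f n) (f m); rewrite (rdistC y); lra.
by have [Nn|nN] := leqP N n; [lia|move=> <-; rewrite subrr rnorm0 ltW].
Qed.

End TotallyBoundedSequences.

(** * Orbits of power-bounded operators and recurrence *)

Section PowerBounded.
Variables (R : realType) (E : completeNormedModType R[i]) (T : {linear E -> E}).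
Implicit Types (x y z : E) (e : R) (l : R[i]).

Lemma iter_lin n l y z : iter n T (l *: y + z) = l *: iter n T y + iter n T z.
Proof. by elim: n => //= n ->; rewrite linearP. Qed.

Lemma iter_lin0 n : iter n T 0 = 0.
Proof. by elim: n => //= n ->; rewrite linear0. Qed.

Lemma iter_linB n y z : iter n T (y - z) = iter n T y - iter n T z.
Proof. by rewrite addrC -scaleN1r iter_lin scaleN1r addrC. Qed.

Lemma iter_linD n y z : iter n T (y + z) = iter n T y + iter n T z.
Proof. by rewrite -[y]scale1r iter_lin !scale1r. Qed.

Lemma iter_linZ n l y : iter n T (l *: y) = l *: iter n T y.
Proof. by rewrite -[l *: y]addr0 iter_lin iter_lin0 addr0. Qed.

Lemma iter_eigen n l y : T y = l *: y -> iter n T y = l ^+ n *: y.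
Proof.
by move=> Ty; elim: n => [|n /= ->]; rewrite ?scale1r// linearZ/= Ty scalerA exprSr.
Qed.

Lemma power_bounded_rnorm : power_bounded T ->
  exists2 M : R, 0 < M & forall n y, rnorm (iter n T y) <= M * rnorm y.
Proof.
rewrite /power_bounded; set s := ereal_sup _ => s_fin.
have sP n y : rnorm y <= 1 -> ((rnorm (iter n T y))%:E <= s)%E.
  move=> y1; apply: (@le_trans _ _ (opnorm (iter n T))).
    by apply: ereal_sup_ubound; exists y.
  by apply: ereal_sup_ubound; exists n.
have s_num : s \is a fin_num.
  by rewrite ge0_fin_numE// (le_trans _ (sP 0%N 0 _)) ?lee_fin ?rnorm_ge0 ?rnorm0.
exists (fine s + 1).
  rewrite ltr_pwDr// -lee_fin fineK//.
  by rewrite (le_trans _ (sP 0%N 0 _)) ?lee_fin ?rnorm_ge0 ?rnorm0.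
move=> n y; have [->|y0] := eqVneq y 0; first by rewrite iter_lin0 rnorm0 mulr0.
have ry0 := rnorm_gt0 y0; have ry1 : 0 < (rnorm y)^-1 by rewrite invr_gt0.
have := sP n ((rnorm y)^-1%:C%C *: y).
rewrite iter_linZ !rnormZ_real ?(ltW ry1)// mulVf ?gt_eqF// => /(_ (lexx _)).
rewrite -[s]fineK// lee_fin ler_pdivrMl// mulrC => /le_trans -> //.
by rewrite ler_wpM2r ?rnorm_ge0// lerDl.
Qed.

(** Linear combinations of asymptotically almost periodic vectors are easier to
    handle with colours than with compact sets. *)
Lemma aapP y : aap T y <-> totally_bounded_seq (fun n => iter n T y).
Proof.
by split; [exact: precompact_totally_bounded|exact: totally_bounded_precompact].
Qed.

Lemma aap_lin l y z : aap T y -> aap T z -> aap T (l *: y + z).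
Proof.
move=> /aapP yb /aapP zb; apply/aapP.
rewrite (_ : (fun n => _) = fun n => l *: iter n T y + iter n T z); last first.
  by apply/funext => n; rewrite iter_lin.
by apply: totally_bounded_seqD zb; exact: totally_bounded_seqZ.
Qed.

Lemma aap0 : aap T 0.
Proof.
apply/aapP; rewrite (_ : (fun n => _) = fun=> 0); last first.
  by apply/funext => n; rewrite iter_lin0.
exact: totally_bounded_seq_cst.
Qed.

Lemma aap_iter k y : aap T y -> aap T (iter k T y).
Proof.
apply: precompact_subset => _ [n _ <-]; exists (n + k)%N => //.
by rewrite iterD.
Qed.

Section Recurrence.
Variables (M : R) (M0 : 0 < M).
Hypothesis TM : forall n y, rnorm (iter n T y) <= M * rnorm y.

(** Two times of the same colour differ by a return time of the orbit of [y].
    For vectors of the reversible part this is the compactness of the group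
    generated by [T] there, in terms of positive powers only. *)
Definition recurrent_vector y := forall e, 0 < e ->
  finitely_colorable (fun m n => rnorm (iter (n - m) T y - y) <= e).

Lemma recurrent0 : recurrent_vector 0.
Proof.
move=> e /ltW e0; exists unit, (fun=> tt) => m n _ _.
by rewrite iter_lin0 subrr rnorm0.
Qed.

Lemma recurrent_lin l y z : recurrent_vector y -> recurrent_vector z ->
  recurrent_vector (l *: y + z).
Proof.
move=> yr zr e e0; have e20 : 0 < e / 2 by rewrite divr_gt0.
have l0 : 0 < rnorm (l : R[i]^o) + 1 by rewrite ltr_wpDl ?rnorm_ge0.
apply: finitely_colorableI (yr _ (divr_gt0 e20 l0)) (zr _ e20) => m n _.
rewrite ler_pdivlMr// => ye ze.
rewrite iter_lin opprD addrACA -scalerBr (le_trans (rnormD _ _))// rnormZ.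
by have := rnorm_ge0 (iter (n - m) T y - y); nra.
Qed.

(** A unimodular eigenvalue acts isometrically on the line of its eigenvector, so
    that two orbit points are as far apart as [y] and the point of the orbit
    at the difference of the times. *)
Lemma eigenvector_recurrent y :
  unimodular_eigenvectors T y -> recurrent_vector y.
Proof.
move=> [/aapP yb [l l1 Ty]] e e0; apply: finitely_colorableW (yb e e0) => m n mn.
rewrite -{1}(subnK mn) !(iter_eigen _ Ty) exprD mulrC -scalerA -scalerBr rnormZ.
suff -> : rnorm (l ^+ m : R[i]^o) = 1 by rewrite mul1r.
by rewrite /rnorm normrX l1 expr1n.
Qed.

Lemma closure_recurrent A : A `<=` recurrent_vector ->
  closure A `<=` recurrent_vector.
Proof.
move=> Ar y /closure_rnormP Ay e e0.
have M1 : 0 < 2 * (M + 1) by rewrite mulr_gt0// addr_gt0.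
have [a /Ar/(_ (e / 2)) + ay] := Ay _ (divr_gt0 e0 M1).
have e20 : 0 < e / 2 by rewrite divr_gt0.
move=> /(_ e20); apply: finitely_colorableW => m n _ ae.
rewrite ltr_pdivlMr// in ay.
have := rdistD (iter (n - m) T a) (iter (n - m) T y) y.
have := rdistD a (iter (n - m) T a) y; rewrite -iter_linB.
have := TM (n - m) (y - a); rewrite [X in _ <= _ * X]rdistC.
by nra.
Qed.

Lemma reversible_recurrent y : reversible_part T y -> recurrent_vector y.
Proof.
apply: closure_recurrent => _ [n [c [a [aP ->]]]].
elim/big_ind : _ => [|u v ur vr|i _]; first exact: recurrent0.
  by rewrite -[u]scale1r; exact: recurrent_lin.
rewrite -[_ *: _]addr0; apply: recurrent_lin; last exact: recurrent0.
exact: eigenvector_recurrent.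
Qed.

End Recurrence.

End PowerBounded.

(** * Almost maximal blocks *)

Section Blocks.
Variables (R : realType) (E : normedModType R[i]).
Implicit Types (x : nat -> E) (v w : E) (p q r n : nat).

Definition block x p q v := (p <= q)%N /\ exists a : nat -> R[i]^o,
  (forall j, rnorm (a j) <= 1) /\ v = \sum_(p <= j < q) a j *: x j.

Lemma block_cat x p q r v w :
  block x p q v -> block x q r w -> block x p r (v + w).
Proof.
move=> [pq [a [a1 ->]]] [qr [b [b1 ->]]]; split; first exact: leq_trans qr.
exists (fun j => if (j < q)%N then a j else b j).
split; first by move=> j; case: ifP.
rewrite (big_cat_nat pq qr)/=; congr (_ + _); apply: eq_big_nat => j.
  by move=> /andP[_ ->].
by move=> /andP[qj _]; rewrite ltnNge qj.
Qed.

Lemma blockZ x p q (l : R[i]^o) v :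
  rnorm l <= 1 -> block x p q v -> block x p q (l *: v).
Proof.
move=> l1 [pq [a [a1 ->]]]; split=> //; exists (fun j => l *: a j); split.
  by move=> j; rewrite rnormZ mulr_ile1 ?rnorm_ge0.
by rewrite scaler_sumr; apply: eq_bigr => j _; rewrite scalerA.
Qed.

Lemma block0 x p q : (p <= q)%N -> block x p q 0.
Proof.
move=> pq; split=> //; exists (fun=> 0); split; first by move=> j; rewrite rnorm0.
by rewrite big1// => j _; rewrite scale0r.
Qed.

Lemma rnorm1 : rnorm (1 : R[i]^o) = 1.
Proof. by rewrite /rnorm normr1. Qed.

Lemma block1 x p : block x p p.+1 (x p).
Proof.
split=> //; exists (fun=> 1); split; first by move=> j; rewrite rnorm1.
by rewrite big_nat1 scale1r.
Qed.

(** Take for [k] the supremum of the sizes that blocks reach however late they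
    start: anything below [k] is always reached again, and anything above [k]
    is out of reach from some index on. *)
Lemma stable_block_size x (B e : R) :
  (forall n v, block x 0 n v -> rnorm v <= B) ->
  0 < e -> (forall j, e <= rnorm (x j)) ->
  exists k : R, [/\ 0 < k,
    exists N, forall q v, block x N q v -> rnorm v <= 7 / 6 * k
  & forall p, exists q v, block x p q v /\ 5 / 6 * k <= rnorm v].
Proof.
move=> xB e0 ex.
pose S := [set t : R | forall p, exists q v, block x p q v /\ t <= rnorm v].
have Se : S e by move=> p; exists p.+1, (x p); split; [exact: block1|].
have S_sup : has_sup S.
  split; first by exists e.
  by exists B => t /(_ 0%N) [q [v [/xB vB tv]]]; exact: le_trans vB.
have k0 : 0 < sup S by rewrite (lt_le_trans e0)// ub_le_sup//; exact: S_sup.2.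
exists (sup S); split=> //.
(* the margin of a sixth on both sides leaves [2 * (5 / 6) - 7 / 6 > 0] for
   the lower estimate of [block_lower] *)
- have : ~ S (7 / 6 * sup S).
    by move=> /(ub_le_sup S_sup.2); lra.
  move=> /existsNP[N NP]; exists N => q v qv; rewrite leNgt; apply/negP => /ltW vk.
  by apply: NP; exists q, v.
- move=> p; have [|t tS kt] := @sup_adherent _ S (sup S / 6) _ S_sup.
    by rewrite divr_gt0.
  have [q [v [qv tv]]] := tS p; exists q, v; split=> //; lra.
Qed.

(** The new sequence consists of consecutive almost maximal blocks of [x].  A
    block of blocks of [x] is a block of [x], hence the upper bound.  This is
    the argument by which James shows that [c0] is not distortable. *)
Lemma almost_extremal_blocks x (B e : R) :
  (forall n v, block x 0 n v -> rnorm v <= B) ->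
  0 < e -> (forall j, e <= rnorm (x j)) ->
  exists (u : nat -> E) (k : R), [/\ 0 < k,
    forall n v, block u 0 n v -> rnorm v <= 7 / 6 * k
  & forall i, 5 / 6 * k <= rnorm (u i)].
Proof.
move=> xB e0 ex; have := stable_block_size xB e0 ex.
move=> [k [k0 [N NP] /choice[q /choice[w wP]]]].
exists (fun i => w (iter i q N)), k; split=> //; last first.
  by move=> i; case: (wP (iter i q N)).
move=> n v [_ [a [a1 ->]]]; apply: (NP (iter n q N)).
elim: n => [|n IHn]; first by rewrite big_geq//; exact: block0.
rewrite big_nat_recr//=; apply: (block_cat IHn).
by apply: blockZ => //; case: (wP (iter n q N)).
Qed.

(** A norm is convex, so that its supremum over a cube is reached at the
    vertices. *)
Lemma vertex_bound x n v (B : R) :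
  (forall b : nat -> bool, rnorm (v + \sum_(j < n | b j) x j) <= B) ->
  forall a : nat -> R, (forall j, 0 <= a j <= 1) ->
  rnorm (v + \sum_(j < n) (a j)%:C%C *: x j) <= B.
Proof.
elim: n v => [|n IHn] v vB a a01.
  by rewrite big_ord0; have := vB xpredT; rewrite big_ord0.
rewrite big_ord_recr /= addrA; set s := \sum_(j < n) _.
have B0 : rnorm (v + s) <= B.
  apply: IHn => // b; have := vB (fun j => (j < n)%N && b j).
  rewrite big_mkcond big_ord_recr/= ltnn/= addr0 [in X in _ -> X]big_mkcond.
  by under eq_bigr do rewrite ltn_ord.
have B1 : rnorm ((v + x n) + s) <= B.
  apply: IHn => // b; have := vB (fun j => (j < n)%N ==> b j).
  rewrite big_mkcond big_ord_recr/= ltnn/= [in X in _ -> X]big_mkcond addrA addrAC.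
  by under eq_bigr do rewrite ltn_ord.
have /andP[an0 an1] := a01 n.
have -> : v + s + (a n)%:C%C *: x n =
    (1 - a n)%:C%C *: (v + s) + (a n)%:C%C *: (v + x n + s).
  rewrite (addrAC v (x n)) (scalerDr _ (v + s)) rmorphB rmorph1 scalerBl.
  by rewrite scale1r addrA subrK.
rewrite (le_trans (rnormD _ _))// !rnormZ_real ?subr_ge0//; nra.
Qed.

(** A coefficient of the unit disc is [p1 - p2 + i (p3 - p4)] with the
    [pi] in the unit interval. *)
Lemma subset_sums_block_bound x (B : R) :
  (forall n (b : nat -> bool), rnorm (\sum_(j < n | b j) x j) <= B) ->
  forall n v, block x 0 n v -> rnorm v <= 4 * B.
Proof.
move=> xB n _ [_ [a [a1 ->]]]; rewrite big_mkord.
have cube (c : nat -> R) : (forall j, 0 <= c j <= 1) ->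
    rnorm (\sum_(j < n) (c j)%:C%C *: x j) <= B.
  by move=> c01; rewrite -[X in rnorm X]add0r vertex_bound// => b; rewrite add0r.
have sym (c : nat -> R) : (forall j, `|c j| <= 1) ->
    rnorm (\sum_(j < n) (c j)%:C%C *: x j) <= 2 * B.
  move=> c1; rewrite (eq_bigr (fun j : 'I_n =>
    (Num.max (c j) 0)%:C%C *: x j - (Num.max (- c j) 0)%:C%C *: x j)); last first.
    move=> j _; rewrite -scalerBl -rmorphB; congr (_%:C%C *: _).
    by rewrite !maxEle oppr_le0; case: (leP (c j) 0) (leP 0 (c j)) => ? [] ?; lra.
  rewrite sumrB (le_trans (rnormB _ _))// mulr_natl mulr2n.
  apply: lerD.
    apply: (cube (fun j => Num.max (c j) 0)) => j.
    by rewrite le_max lexx orbT/= ge_max ler01 andbT (le_trans _ (c1 j))// ler_norm.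
  apply: (cube (fun j => Num.max (- c j) 0)) => j.
  rewrite le_max lexx orbT/= ge_max ler01 andbT (le_trans _ (c1 j))//.
  by rewrite -normrN ler_norm.
rewrite (eq_bigr (fun j : 'I_n => (complex.Re (a j))%:C%C *: x j +
    'i%C *: ((complex.Im (a j))%:C%C *: x j))); last first.
  by move=> j _; rewrite scalerA -scalerDl -complexE.
rewrite big_split/= -scaler_sumr (le_trans (rnormD _ _))// rnormZ.
have -> : rnorm ('i%C : R[i]^o) = 1.
  by rewrite rnormC_def /= expr0n expr1n add0r sqrtr1.
have := sym (fun j => complex.Re (a j)); have := sym (fun j => complex.Im (a j)).
move=> /(_ (fun j => le_trans (Im_le_rnorm _) (a1 j))) Im_le.
by move=> /(_ (fun j => le_trans (Re_le_rnorm _) (a1 j))) Re_le; lra.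
Qed.

End Blocks.

(** * Embeddings of c0 *)

Section NullSequences.
Variable R : realType.
Implicit Types b : c0 R.

Lemma c0_coord_le b i : rnorm (b i) <= rnorm b.
Proof. exact: c0_norm_ub. Qed.

Lemma c0_cvg0 b : b @ \oo --> (0 : R[i]^o).
Proof. by case: b => s s0; apply/null_seqP. Qed.

(** The limit exists coordinatewise, and the coordinates converge uniformly,
    which makes the limit a null sequence. *)
Lemma c0_cauchy_seq_cvg (f : nat -> c0 R) :
  cauchy_seq f -> exists l : c0 R, f @ \oo --> l.
Proof.
move=> fC.
have /choice[l fl] i : exists l : R[i]^o, (fun n => f n i) @ \oo --> l.
  apply: complex_cauchy_seq_cvg => e e0; have [N NP] := fC e e0.
  exists N => m n Nm Nn.
  exact: le_trans (c0_coord_le (f m - f n) i) (NP _ _ Nm Nn).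
have unif e : 0 < e -> exists N, forall n, (N <= n)%N ->
    forall i, rnorm (f n i - l i) <= e.
  move=> e0; have e20 : 0 < e / 2 by rewrite divr_gt0.
  have [N NP] := fC _ e20; exists N => n Nn i.
  have [M MP] := (cvgn_rnormP _ _).1 (fl i) _ e20.
  have := rdistD (f (maxn N M) i) (f n i) (l i).
  have := MP _ (leq_maxr N M).
  have := le_trans (c0_coord_le (f n - f (maxn N M)) i) (NP _ _ Nn (leq_maxl N M)).
  by rewrite -[(f n - _) i]/(f n i - f _ i); lra.
have l0 : l \in @null_seq R.
  apply/null_seqP/cvgn_rnormP => e e0; have e20 : 0 < e / 2 by rewrite divr_gt0.
  have [N /(_ _ (leqnn N)) NP] := unif _ e20.
  have [M MP] := (cvgn_rnormP _ _).1 (c0_cvg0 (f N)) _ e20.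
  exists M => n /MP; rewrite !subr0 => fe.
  by have := rnormB (f N n) (f N n - l n); rewrite subKr; have := NP n; lra.
exists (NullSeq l0); apply/cvgn_rnormP => e e0; have [N NP] := unif e e0.
exists N => n /NP nP.
exact: c0_norm_le.
Qed.

End NullSequences.

Section BoundedBelow.
Variables (R : realType) (F E : normedModType R[i]) (J : {linear F -> E}) (k K : R).
Hypotheses (k0 : 0 < k) (Jk : forall b, k * rnorm b <= rnorm (J b)).
Hypotheses (K0 : 0 < K) (JK : forall b, rnorm (J b) <= K * rnorm b).

Lemma bounded_below_continuous : continuous J.
Proof.
move=> b; apply/cvgrPdist_le => _ /gt0_realP[e e0 ->].
apply/nbhs_ballP; exists (e / K)%:C%C; first by rewrite /= ltcR divr_gt0.
move=> c; rewrite ball_rnorm /= -linearB normE_rnorm lecR => /ltW bc.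
by rewrite (le_trans (JK _))// mulrC -ler_pdivlMr.
Qed.

Lemma bounded_below_inverse : exists g : E -> F,
  cancel J g /\ {within range J, continuous g}.
Proof.
pose g y := xget 0 [set b | J b = y].
have JgK b : J (g (J b)) = J b.
  by apply: (@xgetPex _ 0 [set c | J c = J b]); exists b.
have gJ : cancel J g.
  move=> b; apply/eqP; rewrite -subr_eq0; apply/eqP/rnorm0_eq0/le_anti.
  rewrite rnorm_ge0 andbT -(ler_pM2l k0) mulr0 (le_trans (Jk _))//.
  by rewrite linearB JgK subrr rnorm0.
exists g; split=> //; apply/subspace_continuousP => _ [b _ <-].
apply/cvgrPdist_le => _ /gt0_realP[e e0 ->]; rewrite /within/=.
apply/nbhs_ballP; exists (k * e)%:C%C; first by rewrite /= ltcR mulr_gt0.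
move=> y + [c _ cy]; rewrite -cy ball_rnorm /= /from_subspace !gJ.
rewrite normE_rnorm lecR -linearB => /ltW bc.
by rewrite -(ler_pM2l k0) (le_trans (Jk _)).
Qed.

(** Preimages of a convergent sequence of the range form a Cauchy sequence. *)
Lemma bounded_below_closed :
  (forall f : nat -> F, cauchy_seq f -> exists l : F, f @ \oo --> l) ->
  closed (range J).
Proof.
move=> Fcomplete y /closure_rnormP yJ.
have /choice[f fP] n : exists b, rnorm (J b - y) < n.+1%:R^-1.
  by have [|_ [b _ <-] by_] := yJ n.+1%:R^-1; [rewrite invr_gt0|exists b].
have fcvg e : 0 < e -> exists N, forall n, (N <= n)%N -> rnorm (J (f n) - y) <= e.
  move=> e0; have [N NP] : exists N, N.+1%:R^-1 < e.
    exists (Num.truncn e^-1); rewrite invf_plt ?posrE//.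
    exact: truncnS_gt.
  exists N => n Nn; rewrite (le_trans (ltW (fP n)))// (le_trans _ (ltW NP))//.
  by rewrite lef_pV2 ?posrE// ler_nat.
have [e e0|b fb] := Fcomplete f.
  have ke20 : 0 < k * e / 2 by rewrite divr_gt0// mulr_gt0.
  have [N NP] := fcvg _ ke20; exists N => m n Nm Nn.
  rewrite -(ler_pM2l k0) (le_trans (Jk _))// linearB.
  by have := rdistD y (J (f m)) (J (f n)); rewrite (rdistC y);
    have := NP _ Nm; have := NP _ Nn; lra.
exists b => //; apply/eqP; rewrite -subr_eq0; apply/eqP/rnorm0_eq0/le_anti.
rewrite rnorm_ge0 andbT; apply/ler_addgt0Pr => e e0; rewrite add0r.
have e20 : 0 < e / 2 by rewrite divr_gt0.
have [N NP] := fcvg _ e20.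
have [M MP] := (cvgn_rnormP _ _).1 fb _ (divr_gt0 e20 K0).
have := NP _ (leq_maxl N M); have := MP _ (leq_maxr N M).
set n := maxn N M; rewrite ler_pdivlMr// mulrC => fbn fyn.
have := rdistD (J (f n)) (J b) y; rewrite -linearB.
by have := JK (b - f n); rewrite rdistC; lra.
Qed.

End BoundedBelow.

(** A sequence [u] whose terms are long compared with its blocks: this is
    what makes it behave like the standard basis of [c0]. *)
Section C0Basis.
Variables (R : realType) (E : completeNormedModType R[i]).
Variables (u : nat -> E) (k K : R).
Hypotheses (k0 : 0 < k) (uK : forall n v, block u 0 n v -> rnorm v <= K).
Hypothesis uk : forall i, K + k <= 2 * rnorm (u i).
Implicit Types b : nat -> R[i]^o.

Lemma block_upper b m n (t : R) : 0 <= t -> (m <= n)%N ->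
  (forall i, (m <= i < n)%N -> rnorm (b i) <= t) ->
  rnorm (\sum_(m <= i < n) b i *: u i) <= K * t.
Proof.
move=> t0 mn bt; have [t00|t_neq0] := eqVneq t 0.
  rewrite big_nat_cond big1 ?rnorm0 ?t00 ?mulr0// => i /andP[/bt + _].
  rewrite t00 => bi; rewrite (@rnorm0_eq0 _ _ (b i)) ?scale0r//.
  by apply/le_anti; rewrite bi rnorm_ge0.
have tt0 : 0 < t by rewrite lt_neqAle eq_sym t_neq0.
pose c i : R[i]^o := if (m <= i < n)%N then t^-1%:C%C * b i else 0.
have -> : \sum_(m <= i < n) b i *: u i = t%:C%C *: \sum_(m <= i < n) c i *: u i.
  rewrite scaler_sumr; apply: eq_big_nat => i mni.
  by rewrite /c mni scalerA mulrA -rmorphM mulfV// mul1r.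
rewrite rnormZ_real// mulrC ler_wpM2r//; apply: (uK (n := n)).
rewrite -[X in block _ _ _ X]add0r.
apply: (block_cat (block0 u (leq0n m))); split=> //; exists c; split=> // i.
rewrite /c; case: ifP => [/bt bi|_]; last by rewrite rnorm0.
rewrite (rnormZ_real (b i)) ?invr_ge0//.
by rewrite mulrC ler_pdivrMr// mul1r.
Qed.

(** Let [b i0] be the largest coefficient.  Flipping its sign yields another
    combination, which obeys the upper bound, and the difference of the two is
    the long vector [2 * b i0 *: u i0]. *)
Lemma block_lower b n j : (j < n)%N ->
  k * rnorm (b j) <= rnorm (\sum_(0 <= i < n) b i *: u i).
Proof.
move=> jn; have [i0 _ i0P] :=
  @arg_maxP _ R _ (Ordinal jn) xpredT (fun i : 'I_n => rnorm (b i)) isT.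
have bt i : (0 <= i < n)%N -> rnorm (b i) <= rnorm (b i0).
  by move=> ilt; exact: (i0P (Ordinal ilt) isT).
rewrite (@le_trans _ _ (k * rnorm (b i0)))// ?ler_pM2l ?bt//.
pose c i : R[i]^o := if i == i0 :> nat then - b i else b i.
have := @block_upper c 0 n (rnorm (b i0)) (rnorm_ge0 _) (leq0n n).
have ct i : (0 <= i < n)%N -> rnorm (c i) <= rnorm (b i0).
  by move=> /bt bi; rewrite /c; case: ifP; rewrite ?rnormN.
move=> /(_ ct) cK.
have diff : rnorm (\sum_(0 <= i < n) b i *: u i - \sum_(0 <= i < n) c i *: u i) =
    2 * (rnorm (b i0) * rnorm (u i0)).
  rewrite -sumrB big_mkord (bigD1 i0)//= big1 => [|i ii0]; last first.
    by rewrite /c (negbTE (_ : i != i0 :> nat)) ?subrr.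
  rewrite /c eqxx scaleNr opprK addr0 -mulr2n -scaler_nat.
  by rewrite -(rmorph_nat (real_complex R)) rnormZ_real// rnormZ.
have := rnormB (\sum_(0 <= i < n) b i *: u i) (\sum_(0 <= i < n) c i *: u i).
by rewrite diff; have := ler_wpM2l (rnorm_ge0 (b i0)) (uk i0); lra.
Qed.

Lemma block_K_gt0 : 0 < K.
Proof.
have uKi : rnorm (u 0%N) <= K.
  by apply: (uK (n := 1)); exact: block1.
by have := uk 0%N; have := k0; lra.
Qed.

Lemma block_series_cvg (b : c0 R) :
  exists l : E, (fun n => \sum_(0 <= i < n) b i *: u i) @ \oo --> l.
Proof.
have K0 := block_K_gt0.
apply: cauchy_seq_cvg => e e0; have eK0 : 0 < e / K by rewrite divr_gt0.
have [N NP] := (cvgn_rnormP _ _).1 (@c0_cvg0 R b) _ eK0; exists N.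
suff small m n : (N <= m)%N -> (m <= n)%N ->
    rnorm (\sum_(0 <= i < n) b i *: u i - \sum_(0 <= i < m) b i *: u i) <= e.
  move=> m n Nm Nn; case/orP: (leq_total m n) => mn; last exact: small.
  by rewrite rdistC; exact: small.
move=> Nm mn; rewrite (big_cat_nat (leq0n m) mn)/= addrAC subrr add0r.
rewrite -[e](divfK (lt0r_neq0 K0)) mulrC.
apply: block_upper => //; first exact: ltW.
by move=> i /andP[mi _]; rewrite -[b i]subr0 NP// (leq_trans Nm).
Qed.

Definition block_series (b : c0 R) : E := sval (cid (block_series_cvg b)).

Lemma block_seriesP (b : c0 R) :
  (fun n => \sum_(0 <= i < n) b i *: u i) @ \oo --> block_series b.
Proof. exact: svalP (cid (block_series_cvg b)). Qed.

Arguments block_seriesP : clear implicits.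

Lemma block_series_linear : linear block_series.
Proof.
move=> l b c; apply: (norm_cvg_unique (block_seriesP _)).
rewrite [X in X @ _](_ : _ = fun n => l *: (\sum_(0 <= i < n) b i *: u i) +
    \sum_(0 <= i < n) c i *: u i).
  exact: cvgD (cvgZl_tmp (block_seriesP b)) (block_seriesP c).
apply/funext => n; rewrite scaler_sumr -big_split; apply: eq_bigr => i _.
by rewrite /= scalerA -scalerDl.
Qed.

HB.instance Definition _ := GRing.isLinear.Build R[i] (c0 R) E *:%R
  block_series block_series_linear.

Lemma block_series_contains_c0 : contains_c0 E.
Proof.
have K0 := block_K_gt0.
have JK (b : c0 R) : rnorm (block_series b) <= K * rnorm b.
  apply: (cvgn_rnorm_le (block_seriesP b)) => n.
  by apply: block_upper; rewrite ?rnorm_ge0// => i _; exact: c0_coord_le.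
have Jk (b : c0 R) : k * rnorm b <= rnorm (block_series b).
  rewrite mulrC -ler_pdivlMr//; apply: c0_norm_le => j.
  rewrite ler_pdivlMr// mulrC; apply: (cvgn_rnorm_ge (block_seriesP b) (N := j.+1)).
  by move=> n; exact: block_lower.
have [g [Jg gc]] := bounded_below_inverse k0 Jk.
exists block_series, g; split=> //.
  exact: (bounded_below_closed k0 Jk K0 JK (@c0_cauchy_seq_cvg R)).
exact: (bounded_below_continuous K0 JK).
Qed.

End C0Basis.

(** The Bessaga-Pelczynski criterion.  Passing to almost maximal blocks takes the
    place of the selection of a basic subsequence with the help of functionals. *)
Lemma bounded_subset_sums_contains_c0 (R : realType) (E : completeNormedModType R[i])
    (x : nat -> E) (B e : R) :
  (forall n (b : nat -> bool), rnorm (\sum_(j < n | b j) x j) <= B) ->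
  0 < e -> (forall j, e <= rnorm (x j)) -> contains_c0 E.
Proof.
move=> /subset_sums_block_bound xB e0 ex.
have [u [k [k0 uK uk]]] := almost_extremal_blocks xB e0 ex.
apply: (@block_series_contains_c0 _ _ u (k / 2) (7 / 6 * k)) => //.
  by rewrite divr_gt0.
by move=> i; have := uk i; lra.
Qed.

(** * Sums along recurrent orbits *)

Section BoundedSums.
Variables (R : realType) (E : completeNormedModType R[i]) (T : {linear E -> E}).
Variables (M : R) (M0 : 0 < M).
Hypothesis TM : forall n y, rnorm (iter n T y) <= M * rnorm y.
Variables (z : E) (B : R).
Let s n := \sum_(k < n) iter k T z.
Hypothesis sB : forall n, rnorm (s n) <= B.

Lemma orbit_sumD m n : s (m + n) = s n + iter n T (s m).
Proof.
elim: m => [|m IHm]; first by rewrite [s 0]big_ord0 iter_lin0 addr0.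
rewrite addSn [LHS]big_ord_recr/= -/(s _) IHm [s m.+1]big_ord_recr/= -/(s _).
by rewrite iter_linD addrA -iterD addnC.
Qed.

(** [T] commutes with its powers, so that each of the [n] terms is displaced by
    an image of the displacement of [z]. *)
Lemma orbit_sum_displacement n t :
  rnorm (iter t T (s n) - s n) <= n%:R * (M * rnorm (iter t T z - z)).
Proof.
elim: n => [|n IHn]; first by rewrite [s 0]big_ord0 iter_lin0 subrr rnorm0 mul0r.
rewrite [s n.+1]big_ord_recr/= -/(s _) iter_linD opprD addrACA -iterD addnC iterD.
rewrite -iter_linB (le_trans (rnormD _ _))// -addn1 natrD mulrDl mul1r lerD//.
Qed.

(** This is where the absence of [c0] enters.  Otherwise there are arbitrarily
    good return times [t] with [s t] bounded away from zero.  Choose return times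
    [t j] one after the other, each so good that [s] of any sum of the previous
    ones is hardly moved by [iter (t j) T].  By [orbit_sumD] the sum of
    the [s (t j)] over a finite set of indices is then close to [s] of the sum of
    these [t j], which is bounded. *)
Lemma small_return_small_sum : ~ contains_c0 E -> forall e, 0 < e ->
  exists2 d, 0 < d &
    forall t, rnorm (iter t T z - z) <= d -> rnorm (s t) <= e.
Proof.
move=> noc0 e e0; apply: contrapT => bad; apply: noc0.
have /choice[tau tauP] (d : R) : exists t,
    0 < d -> rnorm (iter t T z - z) <= d /\ e < rnorm (s t).
  have [d0|] := ltP 0 d; last by exists 0%N.
  apply: contrapT => dbad; apply: bad; exists d => // t td.
  by rewrite leNgt; apply/negP => te; apply: dbad; exists t.
(* [d j n] is the quality required of the [j]-th return time when the previous
   ones add up to [n]: it makes the [j]-th error at most [2^-1 ^+ j.+1] *)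
pose d (j n : nat) : R := 2^-1 ^+ j.+1 / (M * n.+1%:R).
have d0 j n : 0 < d j n by rewrite divr_gt0 ?exprn_gt0 ?invr_gt0// mulr_gt0.
pose sg := fix sg n := if n is j.+1 then (sg j + tau (d j (sg j)))%N else 0%N.
pose t j := tau (d j (sg j)).
have tP j : rnorm (iter (t j) T z - z) <= d j (sg j) /\ e < rnorm (s (t j)).
  exact: tauP.
apply: (@bounded_subset_sums_contains_c0 _ _ (fun j => s (t j)) (B + 1) e) => //;
    last first.
  by move=> j; rewrite ltW//; case: (tP j).
move=> n b; pose sb n := (\sum_(j < n | b j) t j)%N.
have sbS m : sb m.+1 = (sb m + if b m then t m else 0)%N.
  by rewrite /sb big_mkcond big_ord_recr/= -big_mkcond.
have sb_le m : (sb m <= sg m)%N.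
  elim: m => [|m IHm]; first by rewrite /sb big_ord0.
  by rewrite sbS leq_add//; case: ifP.
suff : rnorm (\sum_(j < n | b j) s (t j) - s (sb n)) <= 1 - 2^-1 ^+ n.
  have := rdistD (s (sb n)) (\sum_(j < n | b j) s (t j)) 0; rewrite !subr0.
  have := sB (sb n); have : 0 < 2^-1 ^+ n :> R by rewrite exprn_gt0// invr_gt0.
  by lra.
elim: n => [|n IHn].
  by rewrite /sb !big_ord0 [s 0]big_ord0 subrr rnorm0 expr0 subrr.
rewrite sbS big_mkcond big_ord_recr/= -big_mkcond.
have half : 2^-1 ^+ n = 2 * 2^-1 ^+ n.+1 :> R by rewrite exprS mulrA mulfV ?mul1r.
have p0 : 0 < 2^-1 ^+ n.+1 :> R by rewrite exprn_gt0// invr_gt0.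
case: (b n); last by rewrite addr0 addn0 (le_trans IHn)//; lra.
rewrite orbit_sumD addrKA.
have dsp : rnorm (iter (t n) T (s (sb n)) - s (sb n)) <= 2^-1 ^+ n.+1.
  rewrite (le_trans (orbit_sum_displacement _ _))//.
  have [tn _] := tP n; rewrite /d ler_pdivlMr ?mulr_gt0// in tn.
  rewrite (le_trans _ tn)// mulrA mulrC ler_wpM2l ?rnorm_ge0// mulrC.
  by rewrite ler_wpM2l ?(ltW M0)// ler_nat (leq_trans (sb_le n)).
have := rdistD (s (sb n)) (\sum_(j < n | b j) s (t j)) (iter (t n) T (s (sb n))).
rewrite (rdistC (s (sb n))); lra.
Qed.

(** The increment of [s] between two times is the image under a bounded operator
    of [s] at their difference, which is a return time if they have the same
    colour. *)
Lemma orbit_sum_totally_bounded : ~ contains_c0 E ->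
  recurrent_vector T z -> totally_bounded_seq s.
Proof.
move=> noc0 zr e e0.
have [d d0 dP] := small_return_small_sum noc0 (divr_gt0 e0 M0).
apply: finitely_colorableW (zr d d0) => m n mn /dP se.
rewrite -{1}(subnK mn) orbit_sumD addrAC subrr add0r (le_trans (TM _ _))//.
by rewrite mulrC -ler_pdivlMr.
Qed.

End BoundedSums.

(** * Asymptotic almost periodicity from that of the increment *)

Theorem theorem7 (R : realType) (E : completeNormedModType R[i])
    (hc0 : ~ contains_c0 E)
    (T : {linear E -> E}) (hTc : continuous T) (hT : power_bounded T)
    (P : E -> E) (hP : is_jdlg_projection T P)
    (x : E) (hx : aap T (T x - x))
    (hcvg : cvgn (fun n : nat => (iter n T x - x) - P (iter n T x - x))) :
  aap T x.
Proof.
have [M M0 TM] := power_bounded_rnorm hT.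
case: hP => _ Plin [C PC] _ Pcomm Prange _.
pose z := P (T x - x).
have zr : recurrent_vector T z.
  by apply: (reversible_recurrent M0 TM); rewrite -Prange; exists (T x - x).
have Piter k : P (iter k T (T x - x)) = iter k T z.
  by elim: k => //= k <-; rewrite Pcomm//; exact: aap_iter.
have step n : iter n.+1 T x - x = iter n T (T x - x) + (iter n T x - x).
  by rewrite iter_linB -iterSr addrA subrK.
have aapx n : aap T (iter n T x - x).
  elim: n => [|n IHn]; first by rewrite subrr; exact: aap0.
  by rewrite step -[iter n T _]scale1r; apply: aap_lin => //; exact: aap_iter.
have Psum n : P (iter n T x - x) = \sum_(k < n) iter k T z.
  elim: n => [|n IHn].
    rewrite big_ord0 /= subrr; have := Plin 1 0 0 (aap0 T) (aap0 T).
    by rewrite !scale1r addr0 -[LHS]addr0 => /addrI.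
  rewrite big_ord_recr/= -IHn -Piter step -[X in P (X + _)]scale1r.
  by rewrite Plin ?scale1r//; [rewrite addrC|exact: aap_iter].
have Pbounded n : rnorm (\sum_(k < n) iter k T z) <= `|C| * ((M + 1) * rnorm x).
  rewrite -Psum (le_trans (PC _ (aapx n)))//.
  rewrite (@le_trans _ _ (`|C| * rnorm (iter n T x - x)))//.
    by rewrite ler_wpM2r ?rnorm_ge0// ler_norm.
  by rewrite ler_wpM2l// (le_trans (rnormB _ _))// mulrDl mul1r lerD.
have sums := orbit_sum_totally_bounded M0 TM Pbounded hc0 zr.
move/cvg_ex : hcvg => [l /cvg_totally_bounded stable].
apply/aapP; rewrite (_ : (fun n => iter n T x) = fun n =>
    ((iter n T x - x) - P (iter n T x - x)) + \sum_(k < n) iter k T z + x).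
  apply: totally_bounded_seqD (totally_bounded_seq_cst x).
  exact: totally_bounded_seqD stable sums.
by apply/funext => n; rewrite -Psum !subrK.
Qed.
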